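(* Let $N\ge 2$ be an integer and let $t\ge 0$ be fixed. Let $(A,d)$ be an infinite compact metric space with $\operatorname{diam}(A)<1$. Then $$\lim_{s\to\infty}\left(\mathcal{E}^{s}_{\log^t}(A,N)\right)^{1/s}=\frac{1}{\delta_N(A)}.$$ Furthermore, if for each $s\ge 0$ a minimal $N$-point $s,\log^t$-energy configuration $\omega_N^{s,\log^t}$ on $A$ is chosen, then every cluster configuration of $\omega_N^{s,\log^t}$ as $s\to\infty$ is an $N$-point best-packing configuration on $A$.
   Context: $\operatorname{diam}(A):=\sup_{x,y\in A}d(x,y)$. An $N$-point configuration is a set $\omega_N=\{x_1,\dots,x_N\}\subset A$ of $N$ distinct points. For $s,t\ge 0$ define the energy $$E^s_{\log^t}(\omega_N):=\sum_{\substack{x\ne y\\ x,y\in\omega_N}}\frac{1}{d(x,y)^s}\left(\log\frac{1}{d(x,y)}\right)^t$$ (sum over ordered pairs of distinct points; for $t=0$ the logarithmic factor is $1$), and $$\mathcal{E}^s_{\log^t}(A,N):=\min_{\omega_N\subset A,\ \#\omega_N=N}E^s_{\log^t}(\omega_N).$$ The minimum is attained; a minimizer, denoted $\omega_N^{s,\log^t}$ (not necessarily unique), is called a minimal $N$-point $s,\log^t$-energy configuration. The separation distance is $\delta(\omega_N):=\min_{1\le i\ne j\le N}d(x_i,x_j)$, the $N$-point best-packing distance is $\delta_N(A):=\max\{\delta(\omega_N):\omega_N\subset A,\ \#\omega_N=N\}$, and an $N$-point best-packing configuration is an $N$-point configuration attaining this maximum. An $N$-point configuration $\omega_N\subset A$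 is a cluster configuration of $\omega_N^{s,\log^t}$ as $s\to\infty$ if there is a sequence $\{s_k\}_{k=1}^\infty\subset[0,\infty)$ with $s_k\to\infty$ and $\omega_N^{s_k,\log^t}\to\omega_N$ as $k\to\infty$ in the topology of $A^N$ induced by $d$ (configurations being regarded as $N$-tuples of points). *)

(* Defs.v *)
From mathcomp Require Import all_boot all_order all_algebra finmap.
From mathcomp Require Import all_classical all_reals all_analysis.

Set Implicit Arguments.
Unset Strict Implicit.
Unset Printing Implicit Defensive.

Import Order.TTheory GRing.Theory Num.Theory.
Import numFieldNormedType.Exports.

Local Open Scope classical_set_scope.
Local Open Scope ring_scope.

(* The suprema, infima, minima and maxima below are taken with the
   real-valued sup and inf.  On an infinite compact space of diameter < 1, and
   for N >= 2, the sets involved are nonempty and bounded on the relevant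
   side, so the junk values of sup and inf do not occur. *)

Definition diam (R : realType) (A : metricType R) : R :=
  sup [set mdist p.1 p.2 | p in [set: A * A]].

Definition configuration (R : realType) (A : metricType R) (N : nat) :
    set {fset A} :=
  [set w | #|` w| = N].

(* powR satisfies a `^ 0 = 1 for every a, so that the logarithmic factor
   is 1 when t = 0. *)
Definition energy (R : realType) (A : metricType R) (s t : R)
    (w : {fset A}) : R :=
  \sum_(x <- w) \sum_(y <- w | x != y)
     1 / (mdist x y `^ s) * (ln (1 / mdist x y)) `^ t.

Definition minimal_energy (R : realType) (A : metricType R) (s t : R)
    (N : nat) : R :=
  inf [set energy s t w | w in @configuration R A N].

Definition minimal_configuration (R : realType) (A : metricType R) (s t : R)
    (N : nat) (w : {fset A}) : Prop :=
  configuration N w /\ energy s t w = minimal_energy A s t N.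

Definition separation (R : realType) (A : metricType R) (w : {fset A}) : R :=
  inf [set mdist p.1 p.2 | p in
        [set p : A * A | [/\ p.1 \in w, p.2 \in w & p.1 != p.2]]].

Definition packing_distance (R : realType) (A : metricType R) (N : nat) : R :=
  sup [set separation w | w in @configuration R A N].

Definition best_packing (R : realType) (A : metricType R) (N : nat)
    (w : {fset A}) : Prop :=
  configuration N w /\ separation w = packing_distance A N.

Definition enumerates (R : realType) (A : metricType R) (N : nat)
    (x : 'I_N -> A) (w : {fset A}) : Prop :=
  injective x /\ range x = [set` w].

(* Convergence of N-point sets, regarded as points of A^N: for suitable
   orderings of their elements, the resulting tuples converge in the product
   topology. *)
Definition configuration_cvg (R : realType) (A : metricType R) (N : nat)
    (w : nat -> {fset A}) (w0 : {fset A}) : Prop :=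
  exists (x : nat -> prod_topology (fun _ : 'I_N => A))
         (x0 : prod_topology (fun _ : 'I_N => A)),
    [/\ forall k, enumerates (x k) (w k), enumerates x0 w0 &
        x @ \oo --> x0].

Definition cluster_configuration (R : realType) (A : metricType R) (N : nat)
    (w : R -> {fset A}) (w0 : {fset A}) : Prop :=
  configuration N w0 /\
  exists u : nat -> R,
    [/\ forall k, 0 <= u k, u @ \oo --> +oo &
        configuration_cvg N (fun k => w (u k)) w0].

(* Main.v *)
Require Import Defs.
From mathcomp Require Import all_boot all_order all_algebra finmap.
From mathcomp Require Import all_classical all_reals all_analysis.
From mathcomp Require Import lra.

Import Order.TTheory GRing.Theory Num.Theory.
Import numFieldNormedType.Exports.

Local Open Scope classical_set_scope.
Local Open Scope ring_scope.

Set Implicit Arguments.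
Unset Strict Implicit.

(** Let c = ln (1 / diam A) ^ t, which is positive because diam A < 1.  The
    energy of a configuration w is governed by its shortest distance:

    - every pair x != y in w contributes at least c / d(x, y)^s, since d(x, y)
      is at most diam A ([energy_ge_pair]);
    - every distance in w is at least separation w, so comparing the factors
      d^-s term by term leaves the energy with exponent 0, a constant, times
      (separation w)^-s ([energy_le_separation]).

    Write delta for the packing distance.  The shortest pair of any
    configuration has length at most delta, so the minimal energy is at least
    c / delta^s; it is also at most C / r^s whenever r is the separation of
    some N-point configuration.  After taking s-th roots the constants c and C
    disappear in the limit, which leaves 1 / delta as a lower bound for the
    limit and 1 / r as an upper bound, with r as close to delta as desired
    ([cvg_minimal_energy_root]).

    For a cluster configuration, apply the lower bound to one pair of points
    x_k i, x_k j of the minimal configurations along s_k, take s_k-th roots and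
    let k go to infinity.  By the limit already found this reads
    1 / d(x0 i, x0 j) <= 1 / delta, so that every pair of the limit
    configuration is at distance at least delta ([mdist_cluster_ge]). *)

(** * The distance function *)

Lemma continuous_mdist (R : realType) (A : metricType R) :
  continuous (fun p : A * A => mdist p.1 p.2).
Proof.
move=> [x y]; apply/cvgrPdist_lt => e e0 /=.
have e2 : 0 < e / 2 by rewrite divr_gt0.
have xnear : \forall p \near (x, y), mdist x p.1 < e / 2.
  exact: (@metricType_numDomainType.cvgr_dist_lt R A _ _ _ fst _ cvg_fst _ e2).
have ynear : \forall p \near (x, y), mdist y p.2 < e / 2.
  exact: (@metricType_numDomainType.cvgr_dist_lt R A _ _ _ snd _ cvg_snd _ e2).
near=> p.
have px : mdist x p.1 < e / 2 by near: p.
have py : mdist y p.2 < e / 2 by near: p.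
have le1 : mdist x y <= mdist x p.1 + mdist p.1 p.2 + mdist y p.2.
  rewrite (metric_sym y p.2); apply: (le_trans (metric_triangle _ p.2 _)).
  by rewrite lerD2r metric_triangle.
have le2 : mdist p.1 p.2 <= mdist x p.1 + mdist x y + mdist y p.2.
  rewrite (metric_sym x p.1); apply: (le_trans (metric_triangle _ y _)).
  by rewrite lerD2r metric_triangle.
by rewrite ltr_norml; apply/andP; split; lra.
Unshelve. all: by end_near. Qed.

Lemma cvg_mdist (R : realType) (A : metricType R) (T : Type)
    (F : set_system T) {FF : Filter F} (f g : T -> A) (a b : A) :
  f @ F --> a -> g @ F --> b ->
  mdist (f x) (g x) @[x --> F] --> mdist a b.
Proof.
move=> fa gb.
apply: (@continuous2_cvg T A A R F FF f g (fun x y => mdist x y) a b _ fa gb).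
exact: (@continuous_mdist R A (a, b)).
Qed.

(** Compactness of A * A and continuity of the distance bound the set of
    distances, without which its [sup] would say nothing about its elements. *)
Lemma mdist_le_diam (R : realType) (A : metricType R) :
  compact [set: A] -> forall x y : A, mdist x y <= diam A.
Proof.
move=> cA x y; apply: ub_le_sup; last by exists (x, y).
have : compact [set mdist p.1 p.2 | p in [set: A * A]].
  apply: continuous_compact; last by rewrite -setXTT; exact: compact_setX.
  exact/continuous_subspaceT/continuous_mdist.
move=> /compact_bounded[M [_ /(_ (M + 1))]].
rewrite ltrDl ltr01 => /(_ isT) MP; exists (M + 1) => _ [p _ <-].
by apply: le_trans (MP _ _); [exact: ler_norm | exists p].
Qed.

(** * Separation and packing distance *)

Lemma separation_le (R : realType) (A : metricType R) (w : {fset A}) (x y : A) :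
  x \in w -> y \in w -> x != y -> separation w <= mdist x y.
Proof.
move=> xw yw xy; apply: ge_inf; last by exists (x, y).
by exists 0 => _ [p _ <-]; exact: mdist_ge0.
Qed.

(** A configuration has finitely many pairs, so one of them is shortest.  This
    makes the separation positive, and gives every configuration a pair whose
    length is bounded by the packing distance. *)
Lemma separation_attained (R : realType) (A : metricType R) (w : {fset A}) :
  (1 < #|` w|)%N ->
  exists x y, [/\ x \in w, y \in w, x != y & mdist x y = separation w].
Proof.
move=> w1.
have [x xw] : exists x, x \in w by apply/fset0Pn; rewrite -cardfs_gt0 ltnW.
have [y] : exists y, y \in (w `\ x)%fset.
  by apply/fset0Pn; rewrite -cardfs_gt0; move: w1; rewrite (cardfsD1 x) xw.
rewrite !inE => /andP[yx yw].
pose P (p : w * w) := fsval p.1 != fsval p.2.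
have P0 : P ([` xw]%fset, [` yw]%fset) by rewrite /P /= eq_sym.
case: (arg_minP (fun p : w * w => mdist (fsval p.1) (fsval p.2)) P0).
move=> [a b] Pab abmin; exists (fsval a), (fsval b); split => //.
apply/eqP; rewrite eq_le; apply/andP; split; last first.
  by apply: separation_le => //; exact: fsvalP.
apply: lb_le_inf.
  exists (mdist x y), (x, y) => //; split => //=; by rewrite eq_sym.
move=> _ [[u v] [/= uw vw uv] <-].
exact: (abmin ([` uw]%fset, [` vw]%fset)).
Qed.

Lemma separation_gt0 (R : realType) (A : metricType R) (w : {fset A}) :
  (1 < #|` w|)%N -> 0 < separation w.
Proof.
by move=> /separation_attained[x [y [_ _ xy <-]]]; rewrite mdist_gt0.
Qed.

Lemma configuration_nonempty (R : realType) (A : metricType R) (N : nat) :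
  infinite_set [set: A] -> @configuration R A N !=set0.
Proof.
move=> /infinite_set_fset-/(_ N)[B _ NB].
exists [fset x in take N (enum_fset B)]%fset; rewrite /configuration /=.
by rewrite card_fseq undup_id ?take_uniq// size_takel.
Qed.

Lemma has_ubound_separation (R : realType) (A : metricType R) (N : nat) :
  compact [set: A] -> (1 < N)%N ->
  has_ubound [set separation w | w in @configuration R A N].
Proof.
move=> cA N1; exists (diam A) => _ [w Nw <-].
have [|x [y [_ _ _ <-]]] := @separation_attained R A w; first by rewrite Nw.
exact: mdist_le_diam.
Qed.

Lemma separation_le_packing (R : realType) (A : metricType R) (N : nat)
    (w : {fset A}) :
  compact [set: A] -> (1 < N)%N -> configuration N w ->
  separation w <= packing_distance A N.
Proof.
by move=> cA N1 Nw; apply: ub_le_sup; [exact: has_ubound_separation | exists w].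
Qed.

Lemma packing_distance_gt0 (R : realType) (A : metricType R) (N : nat) :
  infinite_set [set: A] -> compact [set: A] -> (1 < N)%N ->
  0 < packing_distance A N.
Proof.
move=> iA cA N1; have [w Nw] := @configuration_nonempty R A N iA.
apply: (lt_le_trans _ (separation_le_packing cA N1 Nw)).
by apply: separation_gt0; rewrite Nw.
Qed.

(** * Two-sided bounds on the energy *)

Lemma energy_ge0 (R : realType) (A : metricType R) (s t : R) (w : {fset A}) :
  0 <= energy s t w.
Proof.
apply: sumr_ge0 => x _; apply: sumr_ge0 => y _.
by rewrite mulr_ge0 ?powR_ge0// divr_ge0 ?powR_ge0.
Qed.

(** All terms of the energy are nonnegative, so a single one bounds it from
    below; the logarithmic factor of that term is smallest at the largest
    possible distance.  The prefactor thus depends neither on the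
    configuration nor on s. *)
Lemma energy_ge_pair (R : realType) (A : metricType R) (D s t : R)
    (w : {fset A}) (x y : A) :
  (forall a b : A, mdist a b <= D) -> D < 1 -> 0 <= t ->
  x \in w -> y \in w -> x != y ->
  ln (1 / D) `^ t / mdist x y `^ s <= energy s t w.
Proof.
move=> AD D1 t0 xw yw xy.
have d0 : 0 < mdist x y by rewrite mdist_gt0.
have D0 : 0 < D by exact: lt_le_trans (AD x y).
have term0 a b : 0 <= 1 / mdist a b `^ s * ln (1 / mdist a b) `^ t.
  by rewrite mulr_ge0 ?powR_ge0// divr_ge0 ?powR_ge0.
rewrite /energy (big_rem x)//= (big_rem y)//= xy.
apply: (@le_trans _ _ (1 / mdist x y `^ s * ln (1 / mdist x y) `^ t)).
  rewrite mulrC !div1r; apply: ler_wpM2l; first by rewrite invr_ge0 powR_ge0.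
  have lnD : 0 <= ln D^-1 by rewrite ln_ge0// invf_ge1// ltW.
  have lnle : ln D^-1 <= ln (mdist x y)^-1.
    by rewrite ler_ln ?posrE ?invr_gt0// lef_pV2 ?posrE.
  by apply: ge0_ler_powR; rewrite ?nnegrE// (le_trans lnD).
rewrite -addrA lerDl addr_ge0//; first exact: sumr_ge0.
by apply: sumr_ge0 => a _; exact: sumr_ge0.
Qed.

(** Exponent 0 keeps only the logarithmic factors, so [energy 0 t w] collects
    everything in the energy of w that does not vary with s. *)
Lemma energy_le_separation (R : realType) (A : metricType R) (s t : R)
    (w : {fset A}) :
  (1 < #|` w|)%N -> 0 <= s ->
  energy s t w <= energy 0 t w / separation w `^ s.
Proof.
move=> w1 s0; rewrite /energy mulr_suml big_seq [leRHS]big_seq.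
apply: ler_sum => x xw; rewrite mulr_suml.
rewrite big_seq_cond [leRHS]big_seq_cond.
apply: ler_sum => y /andP[yw xy].
rewrite powRr0 divr1 !mul1r mulrC; apply: ler_wpM2l; first exact: powR_ge0.
have r0 := separation_gt0 w1.
have d0 : 0 < mdist x y by rewrite mdist_gt0.
rewrite lef_pV2 ?posrE ?powR_gt0//.
by apply: ge0_ler_powR => //; rewrite ?nnegrE ?mdist_ge0 ?(ltW r0)// separation_le.
Qed.

Lemma minimal_energy_le (R : realType) (A : metricType R) (s t : R) (N : nat)
    (w : {fset A}) :
  configuration N w -> minimal_energy A s t N <= energy s t w.
Proof.
move=> Nw; apply: ge_inf; last by exists w.
by exists 0 => _ [v _ <-]; exact: energy_ge0.
Qed.

Lemma minimal_energy_ge (R : realType) (A : metricType R) (s t : R) (N : nat) :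
  infinite_set [set: A] -> compact [set: A] -> diam A < 1 ->
  (1 < N)%N -> 0 <= s -> 0 <= t ->
  ln (1 / diam A) `^ t / packing_distance A N `^ s <= minimal_energy A s t N.
Proof.
move=> iA cA D1 N1 s0 t0; apply: lb_le_inf.
  have [w Nw] := @configuration_nonempty R A N iA.
  by exists (energy s t w), w.
move=> _ [w Nw <-].
have [|x [y [xw yw xy dxy]]] := @separation_attained R A w; first by rewrite Nw.
apply: (le_trans _ (energy_ge_pair _ (mdist_le_diam cA) D1 t0 xw yw xy)).
have d0 : 0 < mdist x y by rewrite mdist_gt0.
apply: ler_wpM2l; first exact: powR_ge0.
have dp : mdist x y <= packing_distance A N.
  by rewrite dxy; exact: separation_le_packing.
rewrite lef_pV2 ?posrE ?powR_gt0 ?(lt_le_trans d0 dp)//.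
by apply: ge0_ler_powR; rewrite ?nnegrE// ltW// (lt_le_trans d0 dp).
Qed.

Lemma ln_inv_diam_gt0 (R : realType) (A : metricType R) :
  infinite_set [set: A] -> compact [set: A] -> diam A < 1 ->
  0 < ln (1 / diam A).
Proof.
move=> iA cA D1; have [w w2] := @configuration_nonempty R A 2 iA.
have [|x [y [_ _ xy _]]] := @separation_attained R A w; first by rewrite w2.
have D0 : 0 < diam A.
  by apply: lt_le_trans (mdist_le_diam cA x y); rewrite mdist_gt0.
by rewrite ln_gt0// div1r invf_gt1.
Qed.

(** * Asymptotics of the minimal energy *)

Lemma root_div_powR (R : realType) (a d s : R) :
  0 <= a -> 0 < d -> s != 0 -> (a / d `^ s) `^ (1 / s) = a `^ (1 / s) / d.
Proof.
move=> a0 d0 s0; rewrite powRM// ?invr_ge0 ?powR_ge0// -powRN -powRrM.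
by rewrite mulNr div1r mulfV// powR_inv1 ?ltW.
Qed.

(** The s-th root sends every positive constant to 1: this is why the
    logarithmic factors leave no trace in the limit. *)
Lemma cvg_root_div (R : realType) (a d : R) : 0 < a ->
  a `^ (1 / s) / d @[s --> +oo] --> 1 / d.
Proof.
move=> a0; apply: cvgM; last exact: cvg_cst.
have inv0 : 1 / s @[s --> +oo] --> (0 : R).
  under eq_fun do rewrite div1r.
  by apply/(@gtr0_cvgV0 R R _ _ id) => //; exact: nbhs_pinfty_gt.
under eq_fun do rewrite /powR gt_eqF//.
have : expR (1 / s * ln a) @[s --> +oo] --> expR (0 * ln a).
  apply: (cvg_comp _ expR); last exact: continuous_expR.
  by apply: cvgM inv0 _; exact: cvg_cst.
by rewrite mul0r expR0.
Qed.

Lemma cvg_minimal_energy_root (R : realType) (N : nat) (t : R)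
    (A : metricType R) :
  (1 < N)%N -> 0 <= t -> infinite_set [set: A] -> compact [set: A] ->
  diam A < 1 ->
  (minimal_energy A s t N) `^ (1 / s) @[s --> +oo] --> 1 / packing_distance A N.
Proof.
move=> N1 t0 iA cA D1; set p := packing_distance A N.
have p0 : 0 < p by exact: packing_distance_gt0.
have c0 : 0 < ln (1 / diam A) `^ t by rewrite powR_gt0// ln_inv_diam_gt0.
apply/cvgrPdist_lt => e e0.
have pe0 : 0 < 1 / p + e by rewrite addr_gt0 ?divr_gt0.
(* The bound on r is equivalent to 1 / r < 1 / p + e. *)
have [r [w Nw rw] rp] : exists2 r,
    [set separation w | w in @configuration R A N] r & (1 / p + e)^-1 < r.
  apply: sup_gt.
    by have [w Nw] := @configuration_nonempty R A N iA; exists (separation w), w.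
  rewrite -/(packing_distance A N) -/p -[ltRHS]invrK ltf_pV2 ?posrE ?invr_gt0//.
  by rewrite div1r ltrDl.
have r0 : 0 < r by rewrite (lt_trans _ rp)// invr_gt0.
have w1 : (1 < #|` w|)%N by rewrite Nw.
have C0 : 0 < energy 0 t w.
  have [x [y [xw yw xy _]]] := separation_attained w1.
  apply: (lt_le_trans _ (energy_ge_pair _ (mdist_le_diam cA) D1 t0 xw yw xy)).
  by rewrite divr_gt0// powRr0.
have lte : 1 / p - e < 1 / p by rewrite gtrBl.
have lower : \forall s \near +oo,
    1 / p - e < ln (1 / diam A) `^ t `^ (1 / s) / p.
  exact: cvgr_gt (cvg_root_div c0) _ lte.
have rpe : 1 / r < 1 / p + e.
  by rewrite div1r -[ltRHS]invrK ltf_pV2 ?posrE ?invr_gt0.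
have upper : \forall s \near +oo, energy 0 t w `^ (1 / s) / r < 1 / p + e.
  exact: cvgr_lt (cvg_root_div C0) _ rpe.
near=> s.
have s0 : 0 < s by near: s; exact: nbhs_pinfty_gt.
have m0 : 0 <= minimal_energy A s t N.
  apply: (le_trans _ (minimal_energy_ge iA cA D1 N1 (ltW s0) t0)).
  by rewrite divr_ge0 ?powR_ge0.
rewrite distrC ltr_distl; apply/andP; split.
  apply: (@lt_le_trans _ _ (ln (1 / diam A) `^ t `^ (1 / s) / p)).
    by near: s.
  rewrite -root_div_powR ?powR_ge0 ?gt_eqF//.
  apply: ge0_ler_powR; rewrite ?nnegrE ?divr_ge0 ?powR_ge0 ?(ltW s0)//.
  exact: (minimal_energy_ge iA cA D1 N1 (ltW s0) t0).
apply: (@le_lt_trans _ _ (energy 0 t w `^ (1 / s) / r)); last by near: s.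
rewrite -root_div_powR ?energy_ge0 ?gt_eqF//.
apply: ge0_ler_powR; rewrite ?nnegrE ?divr_ge0 ?powR_ge0 ?energy_ge0 ?(ltW s0)//.
apply: (le_trans (minimal_energy_le s t Nw)).
by rewrite -rw; exact: (energy_le_separation _ w1 (ltW s0)).
Unshelve. all: by end_near. Qed.

(** * Cluster configurations *)

(** Following a fixed pair of indices, rather than the shortest pair of each
    configuration, makes both sides of the lower bound on the energy converge
    along the sequence. *)
Lemma mdist_cluster_ge (R : realType) (N : nat) (t : R) (A : metricType R)
    (w : nat -> {fset A}) (u : nat -> R)
    (x : nat -> prod_topology (fun _ : 'I_N => A))
    (x0 : prod_topology (fun _ : 'I_N => A)) (i j : 'I_N) :
  (1 < N)%N -> 0 <= t -> infinite_set [set: A] -> compact [set: A] ->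
  diam A < 1 -> u @ \oo --> +oo ->
  (forall k, minimal_configuration (u k) t N (w k)) ->
  (forall k, enumerates (x k) (w k)) -> x @ \oo --> x0 ->
  x0 i != x0 j ->
  packing_distance A N <= mdist (x0 i) (x0 j).
Proof.
move=> N1 t0 iA cA D1 uoo minw xw xx0 x0ij.
have p0 : 0 < packing_distance A N by exact: packing_distance_gt0.
have c0 : 0 < ln (1 / diam A) `^ t by rewrite powR_gt0// ln_inv_diam_gt0.
have d0 : 0 < mdist (x0 i) (x0 j) by rewrite mdist_gt0.
have xcvg l : x k l @[k --> \oo] --> x0 l.
  exact: (cvg_comp _ _ xx0 (@proj_continuous _ _ l x0)).
have dcvg : mdist (x k i) (x k j) @[k --> \oo] --> mdist (x0 i) (x0 j).
  exact: (cvg_mdist (xcvg i) (xcvg j)).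
have lowcvg : ln (1 / diam A) `^ t `^ (1 / u k) / mdist (x k i) (x k j)
    @[k --> \oo] --> 1 / mdist (x0 i) (x0 j).
  apply: cvgM; last by apply: cvgV => //; rewrite gt_eqF.
  have := cvg_comp _ _ uoo (@cvg_root_div R _ 1 c0).
  by rewrite divr1; under eq_fun do rewrite /= divr1.
have Ecvg : minimal_energy A (u k) t N `^ (1 / u k) @[k --> \oo]
    --> 1 / packing_distance A N.
  exact: (cvg_comp _ _ uoo (cvg_minimal_energy_root N1 t0 iA cA D1)).
suff : 1 / mdist (x0 i) (x0 j) <= 1 / packing_distance A N.
  by rewrite !div1r lef_pV2 ?posrE.
apply: (ler_cvg_to lowcvg Ecvg); near=> k.
have uk0 : 0 < u k by near: k; exact: (uoo _ (nbhs_pinfty_gt (num_real 0))).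
have [Nwk <-] := minw k; have [injx rangex] := xw k.
have inw l : x k l \in w k.
  by have : range (x k) (x k l) by [exists l]; rewrite rangex.
have xij : x k i != x k j by apply: contraNneq x0ij => /injx ->.
rewrite -root_div_powR ?powR_ge0 ?mdist_gt0 ?gt_eqF//.
apply: ge0_ler_powR; rewrite ?nnegrE ?divr_ge0 ?powR_ge0 ?energy_ge0 ?(ltW uk0)//.
exact: (energy_ge_pair _ (mdist_le_diam cA) D1 t0 (inw i) (inw j) xij).
Unshelve. all: by end_near. Qed.

Theorem theorem2p1 (R : realType) (N : nat) (hN : (2 <= N)%N)
    (t : R) (ht : 0 <= t) (A : metricType R)
    (hinf : infinite_set [set: A]) (hcomp : compact [set: A])
    (hdiam : diam A < 1) :
  ((minimal_energy A s t N) `^ (1 / s) @[s --> +oo]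
     --> 1 / packing_distance A N) /\
  (forall w : R -> {fset A},
     (forall s : R, 0 <= s -> minimal_configuration s t N (w s)) ->
     forall w0 : {fset A}, cluster_configuration N w w0 ->
       best_packing N w0).
Proof.
split; first exact: cvg_minimal_energy_root.
move=> w minw w0 [Nw0 [u [u0 uoo [x [x0 [xw x0w0 xx0]]]]]]; split => //.
apply/eqP; rewrite eq_le separation_le_packing//=.
have [|a [b [aw bw ab <-]]] := @separation_attained R A w0; first by rewrite Nw0.
have [_ rangex0] := x0w0.
have [i _ ia] : range x0 a by rewrite rangex0.
have [j _ jb] : range x0 b by rewrite rangex0.
rewrite -ia -jb; apply: (@mdist_cluster_ge R N t A (w \o u) u x) => //.
  by move=> k; exact: minw.
by rewrite ia jb.
Qed.
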